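(* For every integer $n \geq 3$, the domination polynomial $D(P_n,x)$ of the path $P_n$ on $n$ vertices is unimodal, and the domination polynomial $D(C_n,x)$ of the cycle $C_n$ on $n$ vertices is unimodal.
   Context: All graphs are finite and undirected (and simple). A subset $S$ of the vertices of a graph $G$ is a dominating set if every vertex of $G$ is either in $S$ or adjacent to a vertex of $S$. Let $d_i(G)$ be the number of dominating sets of $G$ of cardinality $i$. The domination polynomial of $G$ is $D(G,x)=\sum_{i} d_i(G)x^i$, where $0\le i\le |V(G)|$ (coefficients below the domination number are $0$). A real polynomial $a_0+a_1x+\cdots+a_nx^n$ is unimodal if there is $0\le k\le n$ with $a_0\le a_1\le\cdots\le a_k\ge a_{k+1}\ge\cdots\ge a_n$. *)

(* Defs.v *)
From mathcomp Require Import all_boot all_order all_algebra.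

Set Implicit Arguments.
Unset Strict Implicit.
Unset Printing Implicit Defensive.

Import Order.TTheory GRing.Theory Num.Theory.
Local Open Scope ring_scope.

Record sgraph := SGraph {
  vertex :> finType;
  adj : rel vertex;
  adj_sym : symmetric adj;
  adj_irrefl : irreflexive adj
}.

Definition dominating (G : sgraph) (S : {set G}) : bool :=
  [forall v : G, (v \in S) || [exists u in S, adj v u]].

Definition num_dominating (G : sgraph) (i : nat) : nat :=
  #|[set S : {set G} | dominating S & #|S| == i]|.

Definition domination_poly (R : realDomainType) (G : sgraph) : {poly R} :=
  \poly_(i < #|G|.+1) (num_dominating G i)%:R.

(* The indices range up to the degree [(size p).-1] of [p]. *)
Definition unimodal (R : realDomainType) (p : {poly R}) : Prop :=
  exists k : nat,
    [/\ (k <= (size p).-1)%N,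
        forall i : nat, (i < k)%N -> p`_i <= p`_i.+1 &
        forall i : nat, (k <= i < (size p).-1)%N -> p`_i.+1 <= p`_i].

Definition path_rel (n : nat) : rel 'I_n :=
  fun i j => (i.+1 == j :> nat) || (j.+1 == i :> nat).

Lemma path_rel_sym n : symmetric (@path_rel n).
Proof. by move=> i j; rewrite /path_rel orbC. Qed.

Lemma path_rel_irrefl n : irreflexive (@path_rel n).
Proof. by move=> i; rewrite /path_rel orbb; apply/negbTE; rewrite gtn_eqF. Qed.

Definition path_graph (n : nat) : sgraph :=
  SGraph (@path_rel_sym n) (@path_rel_irrefl n).

(* [ordS] is the cyclic successor on ['I_n].  The conjunct [i != j] only
   matters for [n = 1], where it removes a loop. *)
Definition cycle_rel (n : nat) : rel 'I_n :=
  fun i j => (i != j) && ((j == ordS i) || (i == ordS j)).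

Lemma cycle_rel_sym n : symmetric (@cycle_rel n).
Proof. by move=> i j; rewrite /cycle_rel eq_sym orbC. Qed.

Lemma cycle_rel_irrefl n : irreflexive (@cycle_rel n).
Proof. by move=> i; rewrite /cycle_rel eqxx. Qed.

Definition cycle_graph (n : nat) : sgraph :=
  SGraph (@cycle_rel_sym n) (@cycle_rel_irrefl n).

(* Main.v *)
(* Reading a vertex set as a binary word, it dominates the path iff no three consecutive
   letters vanish in the word extended by a [false] on both sides, and it dominates the
   cycle iff this holds cyclically.  Hence the number of dominating sets with k + 1
   elements is the coefficient of t^n in p(t) (t + t^2 + t^3)^k, where
   p(t) = t + 2t^2 + t^3 for the path and p(t) = t + 2t^2 + 3t^3 for the cycle.  For fixed
   k this sequence is log-concave in n without internal zeros, because p is and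
   multiplication by t + t^2 + t^3 preserves this property.  Expanding both sides of
   d_(k+1)^2 >= d_k d_(k+2) in terms of the sequence for k, each product on the right is
   bounded by one on the left; so d is log-concave in k, for fixed n.  It has no internal
   zeros since supersets of dominating sets are dominating, so it is unimodal. *)
Require Import Defs.
From mathcomp Require Import all_boot all_order all_algebra.
From mathcomp Require Import zify.

Set Implicit Arguments.
Unset Strict Implicit.
Unset Printing Implicit Defensive.

(** * Dominating sets of an arbitrary graph *)

Lemma dominatingS (G : sgraph) (S T : {set G}) :
  S \subset T -> dominating S -> dominating T.
Proof.
move=> /subsetP sST /forallP domS; apply/forallP => v.
case/orP: (domS v) => [/sST -> // | /existsP[u /andP[/sST uT vu]]].
by apply/orP; right; apply/existsP; exists u; rewrite uT.
Qed.

Lemma dominatingT (G : sgraph) : dominating [set: G].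
Proof. by apply/forallP => v; rewrite inE. Qed.

Lemma num_dominating_card (G : sgraph) : num_dominating G #|G| = 1.
Proof.
rewrite /num_dominating -(cards1 [set: G]); apply: eq_card => S; rewrite !inE.
apply/andP/eqP => [[_ /eqP cS] | ->]; last by rewrite dominatingT cardsT.
by apply/eqP; rewrite eqEcard subsetT cS cardsT /=.
Qed.

Lemma num_dominating_gt0S (G : sgraph) k :
  0 < num_dominating G k -> k < #|G| -> 0 < num_dominating G k.+1.
Proof.
rewrite /num_dominating !card_gt0 => /set0Pn[S]; rewrite inE.
case/andP=> domS /eqP cS ltk.
have /set0Pn[x xS] : ~: S != set0 by rewrite -card_gt0 cardsCs setCK cS subn_gt0.
apply/set0Pn; exists (x |: S); rewrite inE (dominatingS _ domS) ?subsetUr //=.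
by rewrite cardsU1 cS; move: xS; rewrite inE => ->.
Qed.

Lemma size_domination_poly (R : realDomainType) (G : sgraph) :
  size (domination_poly R G) = #|G|.+1.
Proof.
by apply: size_poly_eq; rewrite num_dominating_card GRing.oner_neq0.
Qed.

Lemma log_concave_unimodal (R : realDomainType) (G : sgraph) :
    (forall k, num_dominating G k * num_dominating G k.+2
               <= num_dominating G k.+1 ^ 2) ->
  unimodal (domination_poly R G).
Proof.
set d := num_dominating G => lc.
have coefd i : i <= #|G| -> ((domination_poly R G)`_i = (d i)%:R)%R.
  by move=> le_i; rewrite coef_poly ltnS le_i.
(* The peak is the first descent; the disjunct [#|G| <= k] gives existence and keeps it within the
   degree. *)
have exP : exists k, (#|G| <= k) || (d k.+1 < d k) by exists #|G|; rewrite leqnn.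
case: (ex_minnP exP) => m descm minm.
have lem : m <= #|G| by apply: minm; rewrite leqnn.
exists m; rewrite size_domination_poly /=; split=> // i.
  move=> ltim; have := contra (minm i).
  rewrite -!ltnNge => /(_ ltim); rewrite negb_or -ltnNge -leqNgt => /andP[lt_i le_d].
  by rewrite !coefd ?Num.Theory.ler_nat // ltnW.
case/andP=> le_mi lt_i; rewrite !coefd ?Num.Theory.ler_nat //; last exact: ltnW.
have {descm} : d m.+1 < d m.
  by case/orP: descm => // /(leq_trans)/(_ le_mi); rewrite leqNgt lt_i.
(* Positivity of [d i] is carried along, since log-concavity propagates the descent only after [d i]
   is cancelled. *)
move=> desc; suff /andP[] : (0 < d i) && (d i.+1 <= d i) by [].
elim: i le_mi lt_i => [|i IH].
  by rewrite leqn0 => /eqP m0 _; rewrite m0 in desc; rewrite (leq_ltn_trans _ desc) // ltnW.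
rewrite leq_eqVlt => /orP[/eqP <- | ltmi] lt_i.
  by rewrite (leq_ltn_trans _ desc) // ltnW.
have /andP[di_gt0 le_d] := IH ltmi (ltnW lt_i).
have dS_gt0 : 0 < d i.+1 by apply: num_dominating_gt0S => //; apply: ltnW.
rewrite dS_gt0 -(leq_pmul2l di_gt0) (leq_trans (lc i)) //.
by rewrite -mulnn leq_mul2r le_d orbT.
Qed.

(** * Log-concavity *)

(* For a sequence with [s 0 = 0], this amounts to log-concavity together with the
   absence of internal zeros, which is what convolution preserves. *)
Definition pf2 (s : nat -> nat) :=
  s 0 = 0 /\ forall i j, i <= j -> s i * s j.+1 <= s i.+1 * s j.

(* The truncated subtractions do no harm, because of [s 0 = 0]. *)
Definition trinomial_step (s : nat -> nat) n := s (n - 1) + s (n - 2) + s (n - 3).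

(** Each induction step moves the two outer indices one unit towards each other. *)
Lemma pf2_mul s a p q : pf2 s -> s a * s (a + p + q) <= s (a + p) * s (a + q).
Proof.
case=> _ lc; elim: p a q => [|p IH] a q; first by rewrite addn0.
case: q => [|q]; first by rewrite !addn0 mulnC.
have -> : a + p.+1 + q.+1 = (a.+1 + p + q).+1 by lia.
apply: leq_trans (lc _ _ _) _; first by lia.
by have := IH a.+1 q; rewrite !addSn !addnS.
Qed.

(** [pf2_mul] in terms of the shifts in [trinomial_step]. Where [i - x] truncates, the left side
    vanishes by [s 0 = 0]. *)
Lemma pf2_sub s i j x y z w :
    pf2 s -> i <= j -> z <= x -> w <= x -> x + y = z + w ->
  s (i - x) * s (j - y) <= s (i - z) * s (j - w).
Proof.
move=> pf le_ij le_zx le_wx e; case: (leqP i x) => lt_xi.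
  by have /eqP -> := lt_xi; rewrite (proj1 pf).
have := pf2_mul (i - x) (x - z) (j - i + x - w) pf.
have -> : i - x + (x - z) = i - z by lia.
have -> : i - z + (j - i + x - w) = j - y by lia.
by have -> : i - x + (j - i + x - w) = j - w by lia.
Qed.

(** Of the nine products on each side four are common; [e1] to [e5] match the other five. *)
Lemma pf2_trinomial_step s : pf2 s -> pf2 (trinomial_step s).
Proof.
move=> pf; split=> [|i j le_ij]; first by rewrite /trinomial_step !sub0n (proj1 pf).
have e1 := pf2_sub (x := 1) (y := 0) (z := 0) (w := 1) pf le_ij isT isT erefl.
have e2 := pf2_sub (x := 2) (y := 0) (z := 0) (w := 2) pf le_ij isT isT erefl.
have e3 := pf2_sub (x := 3) (y := 0) (z := 0) (w := 3) pf le_ij isT isT erefl.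
have e4 := pf2_sub (x := 3) (y := 1) (z := 1) (w := 3) pf le_ij isT isT erefl.
have e5 := pf2_sub (x := 3) (y := 2) (z := 2) (w := 3) pf le_ij isT isT erefl.
rewrite /trinomial_step !subSS; rewrite !subn0 in e1 e2 e3 *.
move: e1 e2 e3 e4 e5; move: (s i) (s (i - 1)) (s (i - 2)) (s (i - 3)).
move: (s j) (s (j - 1)) (s (j - 2)) (s (j - 3)); lia.
Qed.

(* Nine products on each side; each one on the left is dominated by one on the right. *)
Lemma trinomial_step_log_concave s n :
    pf2 s ->
  s n * trinomial_step (trinomial_step s) n <= trinomial_step s n ^ 2.
Proof.
move=> pf.
have e2 := pf2_sub (x := 2) (y := 0) (z := 1) (w := 1) pf (leqnn n) isT isT erefl.
have e3 := pf2_sub (x := 3) (y := 0) (z := 1) (w := 2) pf (leqnn n) isT isT erefl.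
have e4 := pf2_sub (x := 4) (y := 0) (z := 1) (w := 3) pf (leqnn n) isT isT erefl.
have e4' := pf2_sub (x := 4) (y := 0) (z := 2) (w := 2) pf (leqnn n) isT isT erefl.
have e5 := pf2_sub (x := 5) (y := 0) (z := 2) (w := 3) pf (leqnn n) isT isT erefl.
have e6 := pf2_sub (x := 6) (y := 0) (z := 3) (w := 3) pf (leqnn n) isT isT erefl.
rewrite subn0 in e2 e3 e4 e4' e5 e6.
rewrite /trinomial_step -!subnDA !addSn !add0n -mulnn.
move: e2 e3 e4 e4' e5 e6; move: (s n) (s (n - 1)) (s (n - 2)) (s (n - 3)).
move: (s (n - 4)) (s (n - 5)) (s (n - 6)); lia.
Qed.

Lemma log_concave_of_recurrence (F : nat -> nat -> nat) k n :
    pf2 (F 0) -> (forall k n, F k.+1 n = trinomial_step (F k) n) ->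
  F k n * F k.+2 n <= F k.+1 n ^ 2.
Proof.
move=> pf0 rec.
have ext (s t : nat -> nat) : s =1 t -> trinomial_step s =1 trinomial_step t.
  by move=> st m; rewrite /trinomial_step !st.
have pf : pf2 (F k).
  elim: k => // k /pf2_trinomial_step[z lc]; split=> [|i j ij]; first by rewrite rec.
  by rewrite !rec lc.
by rewrite !rec (ext _ _ (rec k)) trinomial_step_log_concave.
Qed.

(** * Counting binary words *)

Fixpoint bitseqs n : seq bitseq :=
  if n is n'.+1 then map (cons true) (bitseqs n') ++ map (cons false) (bitseqs n')
  else [:: [::]].

Lemma mem_bitseqs n w : (w \in bitseqs n) = (size w == n).
Proof.
elim: n w => [|n IH] [|b w] //=.
  by rewrite mem_cat; apply/negbTE/negP => /orP[] /mapP[].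
have inj c : injective (@cons bool c) by move=> ? ? [].
rewrite mem_cat eqSS -IH; case: b; rewrite mem_map //.
  by rewrite orbC; case: mapP => // -[].
by case: mapP => // -[].
Qed.

Lemma bitseqs_uniq n : uniq (bitseqs n).
Proof.
elim: n => //= n IH; have inj c : injective (@cons bool c) by move=> ? ? [].
rewrite cat_uniq !map_inj_uniq // IH andbT /=.
by apply/hasPn => _ /mapP[w _ ->]; apply/mapP => -[].
Qed.

Definition bitset n (w : bitseq) : {set 'I_n} := [set i : 'I_n | nth false w i].

Lemma card_bitset n w : size w = n -> #|bitset n w| = count id w.
Proof.
move=> <-; rewrite -sum1_card big_mkcond -sumn_count sumnE big_map (big_nth false).
rewrite big_mkord; apply: eq_bigr => i _.
by rewrite inE; case: nth.
Qed.

(** [bitset n] is a bijection from words of length [n] to subsets, the inverse being the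
    characteristic word. *)
Lemma card_set_count_bitseqs n (P : pred {set 'I_n}) :
  #|[set S | P S]| = count (fun w => P (bitset n w)) (bitseqs n).
Proof.
rewrite -size_filter -(size_map (bitset n)).
have /card_uniqP <- : uniq [seq bitset n w | w <- bitseqs n & P (bitset n w)].
  rewrite map_inj_in_uniq ?filter_uniq ?bitseqs_uniq // => u w.
  rewrite !mem_filter !mem_bitseqs => /andP[_ /eqP su] /andP[_ /eqP sw] /setP e.
  apply: (@eq_from_nth _ false) => [|i]; first by rewrite su.
  by rewrite su => lti; have := e (Ordinal lti); rewrite !inE.
apply: eq_card => S; rewrite inE; apply/idP/mapP => [PS | [w]]; last first.
  by rewrite mem_filter => /andP[Pw _] ->.
pose w := [seq i \in S | i <- enum 'I_n].
have eS : S = bitset n w.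
  apply/setP => i; rewrite inE (nth_map i) ?size_enum_ord //.
  by rewrite nth_ord_enum.
by exists w; rewrite // mem_filter -eS PS mem_bitseqs size_map size_enum_ord /=.
Qed.

Fixpoint no_fff (w : bitseq) : bool :=
  if w is a :: w' then
    (if w' is b :: c :: _ then [|| a, b | c] else true) && no_fff w'
  else true.

Lemma no_fffP w :
  reflect (forall i, i.+2 < size w ->
             [|| nth false w i, nth false w i.+1 | nth false w i.+2])
          (no_fff w).
Proof.
elim: w => [|a w IH]; first by left.
have -> : no_fff (a :: w) =
  ((1 < size w) ==> [|| a, nth false w 0 | nth false w 1]) && no_fff w.
  by case: {IH} w => [|b [|c w]].
apply: (iffP andP) => [[Hh /IH Ht] [|i] /= lti | H].
- exact: (implyP Hh).
- exact: Ht.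
split; first by apply/implyP => lt1; apply: (H 0).
by apply/IH => i lti; apply: (H i.+1).
Qed.

(** A forbidden window cannot contain the letter [true], so it lies entirely on one side of it. *)
Lemma no_fff_cat_true u w : no_fff (u ++ true :: w) = no_fff u && no_fff w.
Proof.
elim: u => [|a [|b [|c u]] /= IH]; [by case: w => [|b [|c w]] | | |].
- by case: w {IH} => [|b [|c w]]; rewrite /= ?orbT.
- by case: w {IH} => [|c [|d w]]; rewrite /= ?orbT.
- by rewrite IH andbA.
Qed.

Lemma no_fff_nseq n : no_fff (nseq n false) = (n <= 2).
Proof. by case: n => [|[|[|n]]]. Qed.

(** [z] records the run of [false] just read, [c] the boundary condition at the right end. *)
Definition words c z k n :=
  count (fun w => (count id w == k) && no_fff (nseq z false ++ w ++ nseq c false))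
        (bitseqs n).

Lemma count_bitseqsS n (P : pred bitseq) :
  count P (bitseqs n.+1) =
  count (fun w => P (true :: w)) (bitseqs n) +
  count (fun w => P (false :: w)) (bitseqs n).
Proof. by rewrite /= count_cat !count_map. Qed.

Lemma words_fff c k n : words c 3 k n = 0.
Proof.
rewrite /words (eq_count (a2 := pred0)) ?count_pred0 // => w.
by rewrite /= andbF.
Qed.

Lemma words_n0 c z k : words c z k.+1 0 = 0.
Proof. by []. Qed.

Lemma nseq_cat_cons (T : Type) (x : T) z s : nseq z x ++ x :: s = nseq z.+1 x ++ s.
Proof. by elim: z => //= z ->. Qed.

Lemma wordsSS c z k n : z <= 2 ->
  words c z k.+1 n.+1 = words c 0 k n + words c z.+1 k.+1 n.
Proof.
move=> z2; rewrite /words count_bitseqsS; congr (_ + _); apply: eq_count => w.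
  by rewrite /= add1n eqSS no_fff_cat_true no_fff_nseq z2.
by rewrite cat_cons nseq_cat_cons.
Qed.

Lemma words_k0 c z n : words c z 0 n = (z + n + c <= 2).
Proof.
elim: n z => [|n IH] z.
  by rewrite /words /= addn0 -no_fff_nseq nseqD addn0.
rewrite -addSnnS -IH /words count_bitseqsS.
rewrite (eq_count (a2 := pred0)) ?count_pred0 //.
by apply: eq_count => w; rewrite cat_cons nseq_cat_cons.
Qed.

(* The length is shifted by the letter [true] preceding the word. *)
Definition true_words c k n := if n is m.+1 then words c 0 k m else 0.

(** The leading [true] is followed by zero, one or two letters [false] before the next [true];
    removing this block of length 1, 2 or 3 leaves a word of the same kind. *)
Lemma true_wordsS c k n :
  true_words c k.+1 n = trinomial_step (true_words c k) n.
Proof.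
case: n => [|[|[|[|n]]]] //; rewrite /trinomial_step ?subSS ?subn0 ?sub0n /=.
- by rewrite wordsSS // words_n0 !addn0.
- by rewrite !wordsSS // words_n0 addnA.
by rewrite !wordsSS // words_fff addn0 addnA.
Qed.

(** * Domination in paths and cycles in terms of words *)

Lemma nth_cat_nseq_false w c i : nth false (w ++ nseq c false) i = nth false w i.
Proof.
rewrite nth_cat; case: ltnP => // le_wi.
by rewrite nth_nseq if_same nth_default.
Qed.

(** The window starting at position [i] of the extended word is the closed neighbourhood of vertex
    [i]. *)
Lemma dominating_path n w : size w = n ->
  @dominating (path_graph n) (bitset n w) = no_fff (false :: w ++ [:: false]).
Proof.
move=> sw; have nth1 := nth_cat_nseq_false w 1.
apply/forallP/no_fffP => [dom i | H v].
  rewrite /= size_cat sw addn1 !ltnS => lti; rewrite !nth1.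
  have /orP[|/existsP[u]] := dom (Ordinal lti).
    by rewrite inE /= => ->; rewrite orbT.
  rewrite inE => /andP[wu /orP[] /eqP /= e]; first by rewrite e wu !orbT.
  by rewrite -e /= nth1 wu.
have /= := H v; rewrite size_cat sw addn1 !ltnS !nth1 inE => /(_ (ltn_ord v)).
case/or3P => [wv | -> // | wv]; apply/orP; right; apply/existsP.
  case: v wv => -[|i] //= lti; rewrite nth1 => wi.
  by exists (Ordinal (ltnW lti)); rewrite inE /= wi /path_rel /= eqxx orbT.
have ltv : v.+1 < n by rewrite ltnNge; apply: contraL wv => ?; rewrite nth_default ?sw.
by exists (Ordinal ltv); rewrite inE /= wv /path_rel /= eqxx.
Qed.

(* Repeating the first two letters at the end turns the cyclic condition into a linear
   one. *)
Lemma dominating_cycle n w : 2 < n -> size w = n ->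
  @dominating (cycle_graph n) (bitset n w) = no_fff (w ++ take 2 w).
Proof.
case: n => [|n] // n3 sw.
pose x i := nth false w (i %% n.+1).
have nthx i : i < n.+3 -> nth false (w ++ take 2 w) i = x i.
  move=> lti; rewrite nth_cat sw /x; case: ltnP => le_ni; first by rewrite modn_small.
  rewrite nth_take; last by lia.
  by rewrite -{2}(subnK le_ni) modnDr modn_small //; lia.
have size_w2 : size (w ++ take 2 w) = n.+3 by rewrite size_cat size_take sw n3; lia.
have mem_x (v : 'I_n.+1) : (v \in bitset n.+1 w) = x v.
  by rewrite inE /x modn_small.
have x_ordS (v : 'I_n.+1) i : v = i %% n.+1 :> nat -> (ordS v \in bitset n.+1 w) = x i.+1.
  by rewrite mem_x /x /= modn_mod => ->; rewrite -addn1 modnDml addn1.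
apply/forallP/no_fffP => [dom i | H v].
  rewrite size_w2 !ltnS => lti; rewrite !nthx; try by lia.
  (* The window starting at [i] is the closed neighbourhood of the successor of [i]. *)
  pose v : 'I_n.+1 := Ordinal (lti : i < n.+1).
  have /orP[|/existsP[u]] := dom (ordS v).
    by rewrite (x_ordS _ i) ?modn_small // => ->; rewrite orbT.
  case/andP=> wu /andP[_ /orP[] /eqP e].
    move: wu; rewrite e (x_ordS _ i.+1) /=; last by [].
    by move=> ->; rewrite !orbT.
  by move: wu; rewrite -(ordSK u) -e ordSK mem_x => ->.
pose i := ord_pred v; have -> : v = ordS i by rewrite ord_predK.
have := H i; rewrite size_w2 !nthx ?ltnS; try by have := ltn_ord i; lia.
move=> /(_ (ltn_ord i)).
(* [cycle_rel] excludes loops, so its witnesses must differ from their successors. *)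
have ne_ordS (u : 'I_n.+1) : u != ordS u.
  apply/negP => /eqP/(congr1 val)/= e; move: (ltn_ord u); rewrite ltnS leq_eqVlt.
  by case/orP=> [/eqP eu | ltu]; [rewrite eu modnn in e | rewrite modn_small // in e]; lia.
case/or3P => [xi | xi | xi].
- apply/orP; right; apply/existsP; exists i; rewrite mem_x xi /=.
  by rewrite /cycle_rel eq_sym ne_ordS eqxx orbT.
- by rewrite (x_ordS _ i) ?xi // modn_small.
apply/orP; right; apply/existsP; exists (ordS (ordS i)).
by rewrite (x_ordS _ i.+1) // xi /= /cycle_rel ne_ordS eqxx.
Qed.

(** Because of the [false] on the left border, at most one [false] precedes the first [true]. *)
Lemma num_dominating_path n k :
  num_dominating (path_graph n) k.+1 = true_words 1 k n + true_words 1 k (n - 1).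
Proof.
rewrite /num_dominating card_set_count_bitseqs.
have -> : count (fun w => @dominating (path_graph n) (bitset n w)
                          && (#|bitset n w| == k.+1)) (bitseqs n) = words 1 1 k.+1 n.
  apply: eq_in_count => w; rewrite mem_bitseqs => /eqP sw.
  by rewrite dominating_path // card_bitset // andbC.
case: n => [|[|n]]; rewrite ?subSS ?subn0 ?sub0n /=.
- by [].
- by rewrite wordsSS // words_n0.
by rewrite !wordsSS // words_fff addn0.
Qed.

(** The summands correspond to zero, one or two letters [false] before the first [true]. This run
    wraps around to the end, where its length becomes the padding [c]; a longer run contains a
    forbidden window. *)
Lemma num_dominating_cycle n k : 2 < n ->
  num_dominating (cycle_graph n) k.+1 =
  true_words 0 k n + true_words 1 k (n - 1) + true_words 2 k (n - 2).
Proof.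
move=> n3; rewrite /num_dominating card_set_count_bitseqs.
under eq_in_count => w.
  rewrite mem_bitseqs => /eqP sw; rewrite dominating_cycle // card_bitset // andbC.
  over.
case: n n3 => [|[|[|n]]] // _; rewrite !subSS subn0 /true_words /words -addnA.
have fff2 (u v : bitseq) : size v <= 1 -> no_fff (u ++ true :: v) = no_fff u.
  by rewrite no_fff_cat_true; case: v => [|? []]; rewrite ?andbT.
rewrite count_bitseqsS; congr (_ + _).
  apply: eq_count => w; rewrite cats0.
  rewrite -[LHS]/((count id w == k) && no_fff ([::] ++ true :: w ++ true :: take 1 w)).
  by rewrite no_fff_cat_true fff2 // size_take_min geq_minl.
rewrite count_bitseqsS; congr (_ + _).
  apply: eq_count => w.
  rewrite -[LHS]/((count id w == k)
                  && no_fff ([:: false] ++ true :: w ++ [:: false] ++ true :: take 0 w)).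
  by rewrite no_fff_cat_true take0 catA fff2.
rewrite count_bitseqsS [X in _ + X](eq_count (a2 := pred0)) ?count_pred0 ?addn0.
  apply: eq_count => w.
  rewrite -[LHS]/((count id w == k)
                  && no_fff ([:: false; false] ++ true :: w ++ [:: false; false])).
  by rewrite no_fff_cat_true.
by move=> w; rewrite /= andbF.
Qed.

(** * Unimodality *)

Lemma num_dominating0 (G : sgraph) : 0 < #|G| -> num_dominating G 0 = 0.
Proof.
case/card_gt0P=> v _; apply/eqP; rewrite cards_eq0; apply/eqP/setP => S.
rewrite !inE; apply/negP => /andP[/forallP/(_ v)]; rewrite cards_eq0 => dom /eqP S0.
by move: dom; rewrite S0 inE /= => /existsP[u]; rewrite inE.
Qed.

Lemma unimodal_of_trinomial (R : realDomainType) (G : sgraph) n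
    (F : nat -> nat -> nat) :
    0 < #|G| -> (forall k, num_dominating G k.+1 = F k n) ->
    (forall k m, F k.+1 m = trinomial_step (F k) m) -> pf2 (F 0) ->
  unimodal (domination_poly R G).
Proof.
move=> G0 defd recF pfF; apply: log_concave_unimodal => -[|k].
  by rewrite num_dominating0.
by rewrite !defd log_concave_of_recurrence.
Qed.

Theorem corollary2p3 (R : realDomainType) (n : nat) (hn : (3 <= n)%N) :
  unimodal (domination_poly R (path_graph n)) /\
  unimodal (domination_poly R (cycle_graph n)).
Proof.
have n0 : 0 < #|'I_n| by rewrite card_ord; lia.
have tw0 c m : true_words c 0 m = (0 < m) && (m + c <= 3) by case: m => //= m; rewrite words_k0.
split.
  apply: (@unimodal_of_trinomial _ _ n
    (fun k m => true_words 1 k m + true_words 1 k (m - 1))) => //.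
  - exact: num_dominating_path.
  - by move=> k m; rewrite !true_wordsS /trinomial_step -!subnDA !addSn !add0n; lia.
  (* Row 0 is 1, 2, 1 at lengths 1, 2, 3 and zero elsewhere. *)
  by split=> // -[|[|[|[|i]]]] [|[|[|[|j]]]] //; rewrite !tw0; lia.
apply: (@unimodal_of_trinomial _ _ n
    (fun k m => true_words 0 k m + true_words 1 k (m - 1) + true_words 2 k (m - 2))) => //.
- by move=> k; apply: num_dominating_cycle.
- by move=> k m; rewrite !true_wordsS /trinomial_step -!subnDA !addSn !add0n; lia.
(* Row 0 is now 1, 2, 3 at lengths 1, 2, 3 and zero elsewhere. *)
by split=> // -[|[|[|[|i]]]] [|[|[|[|j]]]] //; rewrite !tw0; lia.
Qed.
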